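(* Let $\mathcal R_h$ be either $\mathcal R_h^\flat$ or $\mathcal R_h^\sharp$, with corresponding projection $\mathcal Q_h$. The bilinear form $$a_\Gamma(\lambda,\mu):=a(\mathcal R_h\lambda,\tilde{\mathcal R}_h\mu)-b(\tilde{\mathcal R}_h\mu,p^\lambda)$$ is symmetric and positive definite on $\Lambda_h^0\times\Lambda_h^0$.
   Context: **Domain decomposition.** $\Omega\subset\mathbb R^n$, $n\in\{2,3\}$, is a bounded polygonal domain, split into a fixed finite family of disjoint polygonal subdomains $\Omega_i$, $i\in I_\Omega$, with outward unit normals $\nu_i$. $\Gamma_{ij}=\partial\Omega_i\cap\partial\Omega_j$ are the $(n-1)$-dimensional Lipschitz interfaces; $\Gamma=\bigcup_{i<j}\Gamma_{ij}$, $\Gamma_i=\Gamma\cap\partial\Omega_i$, $I_{int}=\{i:\partial\Omega_i\subseteq\Gamma\}$. $\Lambda=L^2(\Gamma)$; for $\lambda\in\Lambda$, $\lambda_i:=\lambda$ and $\lambda_j:=-\lambda$ on $\Gamma_{ij}$, $i<j$. $(\cdot,\cdot)_G$, $\|\cdot\|_G$ are the $L^2(G)$ inner product and norm. $K$ is a symmetric tensor field with $k_{min}|\xi|^2\le\xi^TK(x)\xi\le k_{max}|\xi|^2$, $0<k_{min}<k_{max}<\infty$. **Discrete spaces.** For each $i$, $V_{h,i}\times W_{h,i}\subset H(\mathrm{div},\Omega_i)\times L^2(\Omega_i)$ is a standard stable mixed finite element pair (e.g. Raviart–Thomas or Brezzi–Douglas–Marini with discontinuous polynomials) on a shape-regular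 affine mesh of $\Omega_i$ (meshes may be non-matching on $\Gamma_{ij}$), with $\nabla\cdot V_{h,i}=W_{h,i}$. $V_{h,i}^0=\{v\in V_{h,i}:\nu_i\cdot v|_{\Gamma_i}=0\}$; $S_{H,i}=\mathbb R$ (constants) if $i\in I_{int}$ and $\{0\}$ otherwise, $S_H=\bigoplus_iS_{H,i}$; $W_{h,i}=\nabla\cdot V_{h,i}^0\oplus S_{H,i}$. $V_{h,i}^\Gamma=(\nu_i\cdot V_{h,i})|_{\Gamma_i}$, $V_h^\Gamma=\bigoplus_iV_{h,i}^\Gamma$; $V_{h,i}^\Gamma$ is the direct sum of its restrictions to the $\Gamma_{ij}\subset\Gamma_i$, each containing constants. $\Lambda_h=\bigoplus_{i<j}\Lambda_{h,ij}$, where $\Lambda_{h,ij}\subset L^2(\Gamma_{ij})$ is a space of continuous or discontinuous piecewise polynomials (containing constants) on a mesh of $\Gamma_{ij}$. **Projections and mortar conditions.** $\mathcal Q_{h,i}^\flat\lambda$ is the $L^2(\Gamma_i)$-projection of $\lambda_i$ onto $V^\Gamma_{h,i}$. $V_{h,c}^\Gamma=\{\xi\in V_h^\Gamma:\sum_i(\xi_i,\mu_h)_{\Gamma_i}=0\ \forall\mu_h\in\Lambda_h\}$, and $\mathcal Q_h^\sharp\lambda=(\mathcal Q_{h,i}^\sharp\lambda)_i$ is the $L^2$-projection of $(\lambda_i)_i\in\bigoplus_iL^2(\Gamma_i)$ onto $V_{h,c}^\Gamma$. It is assumed (standing mortar condition) that there is $C>0$ with $\|\mu_h\|_{\Gamma_{ij}}\le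 C(\|\mathcal Q_{h,i}\mu_h\|_{\Gamma_{ij}}+\|\mathcal Q_{h,j}\mu_h\|_{\Gamma_{ij}})$ for all $\mu_h\in\Lambda_h$ and all $\Gamma_{ij}$, for $\mathcal Q_{h,i}=\mathcal Q^\flat_{h,i}$, and in the case $\mathcal R_h=\mathcal R_h^\sharp$ also for $\mathcal Q_{h,i}=\mathcal Q_{h,i}^\sharp$. **Extensions.** For $\bullet\in\{\flat,\sharp\}$ and $\lambda\in\Lambda$, $(\mathcal R_{h,i}^\bullet\lambda,p_{i}^\lambda,r_i)\in V_{h,i}\times W_{h,i}\times S_{H,i}$ is the unique solution of: $(K^{-1}\mathcal R^\bullet_{h,i}\lambda,v^0)_{\Omega_i}-(\nabla\cdot v^0,p_{i}^\lambda)_{\Omega_i}=0$ for all $v^0\in V_{h,i}^0$; $(\nabla\cdot\mathcal R^\bullet_{h,i}\lambda,w)_{\Omega_i}-(r_i,w)_{\Omega_i}=0$ for all $w\in W_{h,i}$; $(p_{i}^\lambda,s)_{\Omega_i}=0$ for all $s\in S_{H,i}$; $\nu_i\cdot\mathcal R^\bullet_{h,i}\lambda=\mathcal Q^\bullet_{h,i}\lambda$ on $\Gamma_i$. $\mathcal R_h=\bigoplus_i\mathcal R_{h,i}$, $p^\lambda=\bigoplus_ip_i^\lambda$. $\tilde{\mathcal R}_h=\bigoplus_i\tilde{\mathcal R}_{h,i}$ is any linear extension operator $\Lambda_h\to\bigoplus_iV_{h,i}$ with $\nu_i\cdot\tilde{\mathcal R}_{h,i}\mu=\mathcal Q_{h,i}\mu$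 on $\Gamma_i$ (e.g. with all degrees of freedom not on $\Gamma_i$ set to zero). **Forms.** $a(u,v)=(K^{-1}u,v)_\Omega$, $b(u,w)=\sum_i(\nabla\cdot u|_{\Omega_i},w|_{\Omega_i})_{\Omega_i}$. $\Lambda_h^0=\{\mu\in\Lambda_h:b(\tilde{\mathcal R}_h\mu,s)=0\ \forall s\in S_H\}$. *)

(* Defs.v *)
(* Points of R^n are row vectors. *)
From HB Require Import structures.
From mathcomp Require Import all_boot all_order all_algebra.
From mathcomp Require Import all_classical all_reals all_analysis.
(* The notations of mpoly clash with those of MathComp-Analysis. *)
From mathcomp Require Import(canonicals) mpoly.

Set Implicit Arguments.
Unset Strict Implicit.
Unset Printing Implicit Defensive.

Import Order.TTheory GRing.Theory Num.Theory.
Import numFieldNormedType.Exports.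

Local Open Scope classical_set_scope.
Local Open Scope ring_scope.

Section euclid.
Context {R : realType} {n : nat}.
Implicit Types (x y : 'rV[R]_n).

Definition dot x y : R := \sum_(j < n) x 0 j * y 0 j.

(* The canonical norm of ['rV[R]_n] is the maximum norm. *)
Definition enorm x : R := Num.sqrt (dot x x).

Definition ediam (A : set 'rV[R]_n) : \bar R :=
  ereal_sup [set (enorm (x.1 - x.2))%:E | x in A `*` A].

Definition boundary (D : set 'rV[R]_n) : set 'rV[R]_n := closure D `\` D°.

End euclid.

(* ['rV[R]_n] carries the product (that is, Borel) sigma-algebra. *)
Section measurable_row.
Context {R : realType}.
Variable n : nat.

Let coord (i : 'I_n) (x : 'rV[R]_n) : measurableTypeR R := x 0 i.
Let row_measurable : set (set 'rV[R]_n) := g_sigma_preimage coord.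

Let row_set0 : row_measurable set0.
Proof. exact: sigma_algebra0. Qed.

Let row_setC A : row_measurable A -> row_measurable (~` A).
Proof. exact: sigma_algebraC. Qed.

Let row_bigcup (F : (set 'rV[R]_n)^nat) : (forall i, row_measurable (F i)) ->
  row_measurable (\bigcup_i (F i)).
Proof. exact: sigma_algebra_bigcup. Qed.

HB.instance Definition _ := @isMeasurable.Build
  (measure_tuple_display (ocitv_display R))
  'rV[R]_n row_measurable row_set0 row_setC row_bigcup.

End measurable_row.

Section lebesgue_measure_row.
Context {R : realType}.

Definition rsnoc n (z : 'rV[R]_n * measurableTypeR R) : 'rV[R]_n.+1 :=
  \row_i oapp (z.1 0) z.2 (unlift ord_max i).

Lemma measurable_row_coord n (i : 'I_n) :
  measurable_fun setT (fun x : 'rV[R]_n => x 0 i : measurableTypeR R).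
Proof.
move=> _ Y mY; rewrite setTI; apply: sub_sigma_algebra => /=.
rewrite -bigcup_seq/=; exists i => /=; first by rewrite mem_index_enum.
by exists Y => //; rewrite setTI.
Qed.

Lemma measurable_row_fun d (T : measurableType d) n (f : T -> 'rV[R]_n) :
  (forall i, measurable_fun setT (fun t => f t 0 i : measurableTypeR R)) ->
  measurable_fun setT f.
Proof.
move=> mf; suff sub : g_sigma_preimage
    (fun i (x : 'rV[R]_n) => x 0 i : measurableTypeR R) `<=`
    [set A | measurable (f @^-1` A)].
  by move=> _ A mA; rewrite setTI; exact: sub.
apply: smallest_sub => /=.
  split => /=; first by rewrite preimage_set0.
  - by move=> A mA; rewrite setTD preimage_setC; exact: measurableC.
  - by move=> F mF; rewrite preimage_bigcup; exact: bigcup_measurable.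
case: n => [|n] in f mf *; first by rewrite big_ord0.
rewrite -bigcup_mkord_ord; apply: bigcup_sub => i Ii A [B mB <-] /=.
have := mf (inord i) measurableT B mB; rewrite !setTI.
by [].
Qed.

Lemma measurable_rsnoc n : measurable_fun setT (@rsnoc n).
Proof.
apply: measurable_row_fun => i; rewrite /rsnoc.
under eq_fun do rewrite mxE; case: unliftP => [j _|_] /=.
  exact: (measurableT_comp (measurable_row_coord j)).
exact: measurable_snd.
Qed.

Fixpoint lebesgue_row n : {measure set 'rV[R]_n -> \bar R} :=
  if n is m.+1 then
    @measure_function_pushforward__canonical__measure_function_Measure
      _ _ _ _ _ (lebesgue_row m \x (@lebesgue_measure R))%E _
      (@measurable_rsnoc m)
  else dirac (0 : 'rV[R]_0).

End lebesgue_measure_row.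

Section hausdorff.
Context {R : realType} {n : nat}.
Local Open Scope ereal_scope.
Implicit Types A : set 'rV[R]_n.

Fixpoint unit_ball_volume (d : nat) : R :=
  match d with
  | 0 => 1
  | 1 => 2
  | m.+2 => 2 * pi / m.+2%:R * unit_ball_volume m
  end%R.

(* With the factor [unit_ball_volume d / 2 ^ d] the Hausdorff measure agrees
   with the d-dimensional Lebesgue measure on d-dimensional affine subspaces. *)
Definition hausdorff_gauge (d : nat) (delta : R) A : \bar R :=
  if A == set0 then 0 else if ediam A <= delta%:E then
    (unit_ball_volume d * (fine (ediam A) / 2) ^+ d)%:E
  else +oo.

Definition hausdorff (d : nat) A : \bar R :=
  ereal_sup [set mu_ext (hausdorff_gauge d delta) A
            | delta in [set delta : R | (0 < delta)%R]].

Lemma unit_ball_volume_ge0 d : (0 <= unit_ball_volume d)%R.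
Proof.
suff: (0 <= unit_ball_volume d)%R && (0 <= unit_ball_volume d.+1)%R.
  by case/andP.
elim: d => [|d /andP[h0 h1]]; first by rewrite /= ler01 ler0n.
rewrite h1 /= mulr_ge0// divr_ge0 ?ler0n// mulr_ge0 ?ler0n//.
exact: pi_ge0.
Qed.

Lemma hausdorff_gauge0 d delta : hausdorff_gauge d delta set0 = 0.
Proof. by rewrite /hausdorff_gauge eqxx. Qed.

Lemma hausdorff_gauge_ge0 d delta A : 0 <= hausdorff_gauge d delta A.
Proof.
rewrite /hausdorff_gauge; case: ifPn => // A0; case: ifPn => _ //.
rewrite lee_fin mulr_ge0 ?unit_ball_volume_ge0// exprn_ge0// divr_ge0//.
have /set0P[x Ax] := A0.
apply: fine_ge0; apply: le_trans (ereal_sup_ubound _); last first.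
  by exists (x, x).
by rewrite lee_fin sqrtr_ge0.
Qed.

Lemma hausdorff0 d : hausdorff d set0 = 0.
Proof.
rewrite /hausdorff; apply/eqP; rewrite eq_le; apply/andP; split.
  apply: ge_ereal_sup => _ [delta _ <-].
  by rewrite (mu_ext0 (hausdorff_gauge0 d delta) (hausdorff_gauge_ge0 d delta)).
apply: ereal_sup_ubound; exists 1%R; first exact: ltr01.
by rewrite (mu_ext0 (hausdorff_gauge0 d 1) (hausdorff_gauge_ge0 d 1)).
Qed.

Lemma hausdorff_ge0 d A : 0 <= hausdorff d A.
Proof.
apply: le_trans (mu_ext_ge0 (hausdorff_gauge_ge0 d 1) A) _.
by apply: ereal_sup_ubound; exists 1%R => //=; exact: ltr01.
Qed.

Lemma le_hausdorff d : {homo hausdorff d : A B / A `<=` B >-> A <= B}.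
Proof.
move=> A B AB; apply: ge_ereal_sup => _ [delta d0 <-].
apply: le_trans (le_mu_ext _ AB) _.
by apply: ereal_sup_ubound; exists delta.
Qed.

Lemma hausdorff_sigma_subadditive d : sigma_subadditive (hausdorff d).
Proof.
move=> F; apply: ge_ereal_sup => _ [delta d0 <-].
apply: le_trans (mu_ext_sigma_subadditive (hausdorff_gauge_ge0 d delta) F) _.
apply: lee_nneseries => [i _|i _].
  by move=> _; exact: (mu_ext_ge0 (hausdorff_gauge_ge0 d delta)).
by apply: ereal_sup_ubound; exists delta.
Qed.

HB.instance Definition _ d := isOuterMeasure.Build R 'rV[R]_n (hausdorff d)
  (hausdorff0 d) (hausdorff_ge0 d) (@le_hausdorff d)
  (@hausdorff_sigma_subadditive d).

End hausdorff.

Definition hausdorff_outer (R : realType) (n d : nat) :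
  {outer_measure set 'rV[R]_n -> \bar R} := @hausdorff R n d.

(* A copy of ['rV[R]_n] with the sigma-algebra of the sets that are measurable
   for the (n-1)-dimensional Hausdorff outer measure. *)
Notation surface_type R n := (caratheodory_type (hausdorff_outer R n n.-1)).

Definition surface (R : realType) (n : nat) :
  {measure set (surface_type R n) -> \bar R} := hausdorff_outer R n n.-1.

Section L2.
Context d {T : measurableType d} {R : realType}.
Variables (mu : {measure set T -> \bar R}) (D : set T).
Implicit Types f g : T -> R.

Definition L2 f : Prop := f \_ D \in Lfun mu 2%:E.

Definition L2ip f g : R := \int[mu]_(x in D) (f x * g x).

Definition L2norm f : R := Num.sqrt (L2ip f f).

End L2.

Section geometry.
Context {R : realType} {n : nat}.
Local Notation pt := 'rV[R]_n.
Implicit Types (A D F : set pt) (x y v : pt).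

Definition hull (m : nat) (p : 'I_m -> pt) : set pt :=
  [set x | exists w : 'I_m -> R, [/\ forall i, 0 <= w i, \sum_i w i = 1
                                 & x = \sum_i w i *: p i]].

Definition polytope A : Prop := exists m (p : 'I_m -> pt), A = hull p.

Definition solid_polytope A : Prop := polytope A /\ A° !=set0.

Definition flat_polytope A : Prop :=
  polytope A /\ exists v c, v != 0 /\ A `<=` [set x | dot x v = c].

Definition face A F : Prop := F `<=` A /\
  forall x y t, A x -> A y -> 0 < t < 1 -> F (t *: x + (1 - t) *: y) ->
    F x /\ F y.

Record polygonal_domain D : Prop := PolygonalDomain {
  polygonal_open : open D;
  polygonal_neq0 : D !=set0;
  polygonal_connected : connected D;
  (* no slits *)
  polygonal_regular : (closure D)° = D;
  polygonal_closure : exists N (E : 'I_N -> set pt),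
    (forall k, solid_polytope (E k)) /\ closure D = \bigcup_k E k }.

Definition outward_normal D x v : Prop := dot v v = 1 /\
  exists2 e : R, 0 < e &
    forall y, enorm (y - x) < e -> (D y <-> dot (y - x) v < 0).

(* Outward unit normal of a polygonal domain; it exists at almost every
   boundary point and has the junk value 0 where it does not. *)
Definition normal D x : pt := xget 0 [set v | outward_normal D x v].

Record domain_decomposition (M : nat) (Om : set pt) (Omi : 'I_M -> set pt) :
    Prop := DomainDecomposition {
  decomposition_domain : polygonal_domain Om;
  decomposition_subdomain : forall i, polygonal_domain (Omi i);
  decomposition_sub : forall i, Omi i `<=` Om;
  decomposition_disjoint : forall i j, i != j -> Omi i `&` Omi j = set0;
  decomposition_cover : closure Om = \bigcup_i closure (Omi i) }.

Section interfaces.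
Context {M : nat}.
Variable Omi : 'I_M -> set pt.

Definition interface (i j : 'I_M) : set pt :=
  boundary (Omi i) `&` boundary (Omi j).

Definition Gamma : set pt :=
  [set x | exists i j : 'I_M, (i < j)%N /\ interface i j x].

Definition Gamma_of (i : 'I_M) : set pt := Gamma `&` boundary (Omi i).

Definition interior_subdomain (i : 'I_M) : Prop := boundary (Omi i) `<=` Gamma.

(* lambda_i: the sign is + on Gamma_ij with i < j and - on Gamma_ij with j < i;
   different interfaces overlap in surface null sets only. *)
Definition side (lambda : pt -> R) (i : 'I_M) (x : pt) : R :=
  if `[< exists j : 'I_M, (i < j)%N /\ interface i j x >] then lambda x
  else - lambda x.

End interfaces.

Record shape_regular_affine_mesh (sigma : R) D (N : nat) (T : 'I_N -> set pt) :
    Prop := ShapeRegularAffineMesh {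
  mesh_affine : exists2 Khat, solid_polytope Khat & forall k,
    exists B : 'M[R]_n, exists2 b : pt,
      B \in unitmx & T k = [set x *m B + b | x in Khat];
  mesh_cover : closure D = \bigcup_k T k;
  mesh_disjoint : forall k l, k != l -> (T k)° `&` (T l)° = set0;
  mesh_conforming : forall k l, face (T k) (T k `&` T l);
  mesh_shape_regular : forall k, exists x, exists2 r : R, 0 < r &
    [set y | enorm (y - x) <= r] `<=` T k /\ (ediam (T k) <= (sigma * r)%:E)%E
  }.

Definition elliptic_tensor Om (K : pt -> 'M[R]_n) (kmin kmax : R) : Prop :=
  [/\ 0 < kmin, kmin < kmax,
      forall i j, measurable_fun Om (fun x => K x i j : measurableTypeR R),
      forall x, Om x -> (K x)^T = K x &
      forall x, Om x -> forall xi : pt,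
        kmin * dot xi xi <= dot (xi *m K x) xi <= kmax * dot xi xi].

End geometry.

Section Hdiv.
Context {R : realType} {n : nat}.
Local Notation pt := 'rV[R]_n.

Definition partial (j : 'I_n) (f : pt -> R) (x : pt) : R :=
  'D_(delta_mx 0 j) f x.

Definition smooth (f : pt -> R) : Prop := forall s : seq 'I_n,
  continuous (foldr partial f s) /\
  forall j x, derivable (foldr partial f s) x (delta_mx 0 j).

Definition test_function (D : set pt) (phi : pt -> R) : Prop :=
  [/\ smooth phi, compact (closure [set x | phi x != 0]) &
      closure [set x | phi x != 0] `<=` D].

(* [u] belongs to H(div, D), and its weak divergence is [g]. *)
Definition Hdiv (D : set pt) (u : pt -> pt) (g : pt -> R) : Prop :=
  [/\ forall j, L2 (lebesgue_row n) D (fun x => u x 0 j),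
      L2 (lebesgue_row n) D g &
      forall phi, test_function D phi ->
        \int[lebesgue_row n]_(x in D) (\sum_j u x 0 j * partial j phi x) =
        - L2ip (lebesgue_row n) D g phi].

End Hdiv.

(* One polynomial, resp. one vector of polynomials, per mesh element. *)
Notation broken R n N := {ffun 'I_N -> mpoly.mpoly n R}.
Notation vbroken R n N := {ffun 'I_N -> {ffun 'I_n -> mpoly.mpoly n R}}.

Section broken.
Context {R : realType} {n N : nat}.
Local Notation pt := 'rV[R]_n.

Definition peval (q : mpoly.mpoly n R) (x : pt) : R :=
  mpoly.meval (fun j => x 0 j) q.

Definition vpeval (q : {ffun 'I_n -> mpoly.mpoly n R}) (x : pt) : pt :=
  \row_j peval (q j) x.

Variable T : 'I_N -> set pt.

(* The function is the polynomial [w k] inside the element [T k], and 0 outside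
   the interiors of the elements. *)
Definition beval (w : broken R n N) (x : pt) : R :=
  \sum_k \1_((T k)°) x * peval (w k) x.

Definition vbeval (v : vbroken R n N) (x : pt) : pt :=
  \sum_k \1_((T k)°) x *: vpeval (v k) x.

Definition bdiv (v : vbroken R n N) : broken R n N :=
  [ffun k => \sum_j mpoly.mderiv j (v k j)].

(* Normal trace, from inside [D], on the boundary of the meshed domain [D]: all
   boundary points but a surface null set lie in exactly one element. *)
Definition ntrace (D : set pt) (v : vbroken R n N) (x : pt) : R :=
  \sum_k \1_(T k) x * dot (vpeval (v k) x) (normal D x).

End broken.
Definition fin_dim_subspace (R : realType) (E : lmodType R) (V : set E) : Prop :=
  exists m (e : 'I_m -> E), V = [set \sum_i c i *: e i | c in [set: 'I_m -> R]].

Section spaces.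
Context {R : realType} {n M : nat}.
Local Notation pt := 'rV[R]_n.
Local Notation leb := (@lebesgue_row R n).
Local Notation surf := (surface R n).
Variable Omi : 'I_M -> set pt.

Definition Lambda (lambda : pt -> R) : Prop := L2 surf (Gamma Omi) lambda.

Section subdomain.
Variables (i : 'I_M) (N : nat) (T : 'I_N -> set pt).
Variables (V : set (vbroken R n N)) (W : set (broken R n N)).

(* the space S_{H,i}, as constant piecewise polynomials *)
Definition coarse (s : broken R n N) : Prop :=
  exists2 c : R, s = [ffun=> mpoly.mpolyC n c] &
    ~ interior_subdomain Omi i -> c = 0.

Definition V0 : set (vbroken R n N) := [set v | V v /\
  ae_eq surf (Gamma_of Omi i) (ntrace T (Omi i) v) (cst 0)].

(* V_{h,i}^Gamma, as a set of functions that is closed under equality almost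
   everywhere on Gamma_i *)
Definition VGamma : set (pt -> R) := [set xi | exists2 v, V v &
  ae_eq surf (Gamma_of Omi i) xi (ntrace T (Omi i) v)].

Record mixed_pair : Prop := MixedPair {
  mixed_V_subspace : fin_dim_subspace V;
  mixed_W_subspace : fin_dim_subspace W;
  mixed_Hdiv : forall v, V v -> Hdiv (Omi i) (vbeval T v) (beval T (bdiv v));
  mixed_div : W = [set bdiv v | v in V];
  mixed_sum : forall w, W w <->
    exists v s, [/\ V0 v, coarse s & w = bdiv v + s];
  mixed_direct : forall v, V0 v -> coarse (bdiv v) -> bdiv v = 0;
  (* discrete inf-sup condition *)
  mixed_stable : exists2 beta : R, 0 < beta & forall w, W w ->
    exists v, [/\ V v,
      \int[leb]_(x in Omi i) dot (vbeval T v x) (vbeval T v x)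
        + L2norm leb (Omi i) (beval T (bdiv v)) ^+ 2 <= 1 &
      beta * L2norm leb (Omi i) (beval T w) <=
        L2ip leb (Omi i) (beval T (bdiv v)) (beval T w)];
  (* V_{h,i}^Gamma is the direct sum of its restrictions to the interfaces *)
  mixed_restrict : forall j, j != i -> forall xi, VGamma xi ->
    VGamma (xi \_ (interface Omi i j));
  mixed_constant : forall j, j != i -> VGamma (\1_(interface Omi i j)) }.

(* [(u, p, r)] solves the discrete Neumann problem on Omega_i with the
   boundary data [q] on Gamma_i. *)
Record is_extension (K : pt -> 'M[R]_n) (q : pt -> R) (u : vbroken R n N)
    (p r : broken R n N) : Prop := IsExtension {
  extension_V : V u;
  extension_W : W p;
  extension_S : coarse r;
  extension_darcy : forall v0, V0 v0 ->
    \int[leb]_(x in Omi i) dot (vbeval T u x *m invmx (K x)) (vbeval T v0 x)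
      - L2ip leb (Omi i) (beval T (bdiv v0)) (beval T p) = 0;
  extension_mass : forall w, W w ->
    L2ip leb (Omi i) (beval T (bdiv u)) (beval T w)
      - L2ip leb (Omi i) (beval T r) (beval T w) = 0;
  extension_mean : forall s, coarse s ->
    L2ip leb (Omi i) (beval T p) (beval T s) = 0;
  extension_trace : ae_eq surf (Gamma_of Omi i) (ntrace T (Omi i) u) q }.

End subdomain.

(* Lambda_{h,ij}, closed under equality almost everywhere on [G] = Gamma_ij *)
Record mortar_space (G : set pt) (L : set (pt -> R)) : Prop := MortarSpace {
  mortar_L2 : forall mu, L mu -> L2 surf G mu;
  mortar_subspace : exists m (e : 'I_m -> pt -> R), L =
    [set mu | exists c : 'I_m -> R,
              ae_eq surf G mu (fun x => \sum_k c k * e k x)];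
  mortar_constant : forall c : R, L (cst c);
  mortar_polynomial : exists N (E : 'I_N -> set pt),
    [/\ forall k, flat_polytope (E k), G = \bigcup_k E k,
        forall k l, k != l -> surf (E k `&` E l) = 0%E &
        forall mu, L mu -> exists q : 'I_N -> mpoly.mpoly n R,
          forall k, ae_eq surf (E k) mu (peval (q k))] }.

Section mortar.
Variables (N : 'I_M -> nat) (T : forall i, 'I_(N i) -> set pt).
Variable V : forall i, set (vbroken R n (N i)).
Variable L : 'I_M -> 'I_M -> set (pt -> R).
Local Arguments T : clear implicits.
Local Arguments V : clear implicits.

Definition Lambda_h (mu : pt -> R) : Prop :=
  Lambda mu /\ forall i j : 'I_M, (i < j)%N -> L i j mu.

(* V_{h,c}^Gamma *)
Definition VGamma_c (xi : 'I_M -> pt -> R) : Prop :=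
  (forall i, VGamma i (T i) (V i) (xi i)) /\
  forall mu, Lambda_h mu -> \sum_i L2ip surf (Gamma_of Omi i) (xi i) mu = 0.

Definition flat_projection (lambda : pt -> R) (q : 'I_M -> pt -> R) : Prop :=
  forall i, VGamma i (T i) (V i) (q i) /\
    forall xi, VGamma i (T i) (V i) xi ->
      L2ip surf (Gamma_of Omi i) (fun x => side Omi lambda i x - q i x) xi = 0.

Definition sharp_projection (lambda : pt -> R) (q : 'I_M -> pt -> R) : Prop :=
  VGamma_c q /\ forall xi, VGamma_c xi ->
    \sum_i L2ip surf (Gamma_of Omi i)
      (fun x => side Omi lambda i x - q i x) (xi i) = 0.

Definition mortar_condition (Q : (pt -> R) -> 'I_M -> pt -> R) : Prop :=
  exists2 C : R, 0 < C & forall mu, Lambda_h mu ->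
    forall i j : 'I_M, (i < j)%N ->
      L2norm surf (interface Omi i j) mu <=
      C * (L2norm surf (interface Omi i j) (Q mu i) +
           L2norm surf (interface Omi i j) (Q mu j)).

Definition vglobal (u : forall i, vbroken R n (N i)) (x : pt) : pt :=
  \sum_i vbeval (T i) (u i) x.

Definition a_form (Om : set pt) (K : pt -> 'M[R]_n)
    (u v : forall i, vbroken R n (N i)) : R :=
  \int[leb]_(x in Om) dot (vglobal u x *m invmx (K x)) (vglobal v x).

Definition b_form (u : forall i, vbroken R n (N i))
    (w : forall i, broken R n (N i)) : R :=
  \sum_i L2ip leb (Omi i) (beval (T i) (bdiv (u i))) (beval (T i) (w i)).

Section extension.
Variable Rt : (pt -> R) -> forall i, vbroken R n (N i).
Local Arguments Rt : clear implicits.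

Record extension_operator (Q : (pt -> R) -> 'I_M -> pt -> R) : Prop :=
  ExtensionOperator {
  extop_V : forall mu, Lambda_h mu -> forall i, V i (Rt mu i);
  extop_linear : forall mu mu', Lambda_h mu -> Lambda_h mu' ->
    forall (c : R) i,
      Rt (fun x => c * mu x + mu' x) i = c *: Rt mu i + Rt mu' i;
  extop_trace : forall mu, Lambda_h mu -> forall i,
    ae_eq surf (Gamma_of Omi i) (ntrace (T i) (Omi i) (Rt mu i)) (Q mu i) }.

Definition Lambda_h0 (mu : pt -> R) : Prop := Lambda_h mu /\
  forall s : (forall i, broken R n (N i)),
    (forall i, coarse i (s i)) -> b_form (Rt mu) s = 0.

Definition a_Gamma (Om : set pt) (K : pt -> 'M[R]_n)
    (Rh : (pt -> R) -> forall i, vbroken R n (N i))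
    (p : (pt -> R) -> forall i, broken R n (N i)) (lambda mu : pt -> R) : R :=
  a_form Om K (Rh lambda) (Rt mu) - b_form (Rt mu) (p lambda).

End extension.
End mortar.
End spaces.

Inductive variant := Flat | Sharp.

(* Main.v *)
(** Let [A(u, v)] be the sum over the subdomains of the integrals of
    [K^-1 u . v].  For [lambda] and [mu] in [Lambda_h] the difference of
    [Rt mu] and [Rh mu] has no normal trace, so Darcy's law for [Rh lambda]
    may be tested with it; moreover [div (Rh mu)] acts on the pressures like an
    element of the coarse space, to which [p lambda] is orthogonal.  Hence
    [a_Gamma lambda mu = A (Rh lambda, Rh mu)], which is symmetric and
    nonnegative.  If [A (Rh lambda, Rh lambda) = 0], then the polynomials
    forming [Rh lambda] vanish on open sets, hence everywhere, so that the
    normal traces [Q lambda] vanish, and [lambda = 0] on the interfaces by the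
    mortar condition. *)
Require Import Defs.
From mathcomp Require Import all_boot all_order all_algebra.
From mathcomp Require Import all_classical all_reals all_analysis.
From mathcomp Require Import measurable_realfun.
From mathcomp Require Import ring lra.
From mathcomp Require Import(canonicals) mpoly.

Set Implicit Arguments.
Unset Strict Implicit.
Unset Printing Implicit Defensive.

Import Order.TTheory GRing.Theory Num.Theory.
Import numFieldNormedType.Exports.

Local Open Scope classical_set_scope.
Local Open Scope ring_scope.

(** * Borel sets of row space and the positivity of Lebesgue measure on balls *)

Section row_space.
Context {R : realType}.

(** Balls are taken in the maximum norm, hence are finite intersections of preimages of intervals
    under the coordinates, which generate the sigma-algebra. *)
Lemma measurable_ball_row n (x : 'rV[R]_n) (e : R) : measurable (ball x e).
Proof.
(* For [n = 0] the coordinate conditions are void, so the empty balls with [e <= 0] are treated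
   apart. *)
have [e0|e0] := leP e 0.
  rewrite (_ : ball x e = set0)//; apply/seteqP; split => // y [+ _].
  by rewrite ltNge e0.
rewrite (_ : ball x e =
    \bigcap_(i in [set: 'I_n]) ((fun y : 'rV[R]_n => y 0 i) @^-1` ball (x 0 i) e)).
  apply: fin_bigcap_measurable; first exact: finite_finset.
  move=> i _; rewrite -[X in measurable X]setTI.
  apply: (measurable_row_coord i) => //.
  exact: open_measurable (ball_open _ _).
apply/seteqP; split => y; first by move=> [_ xy] i _; exact: xy.
move=> xy; split => // i j; rewrite ord1; exact: xy.
Qed.

(** An open set is the union of the balls with rational centre and radius that it contains, and
    there are countably many of these. *)
Lemma open_measurable_row n (A : set 'rV[R]_n) : open A -> measurable A.
Proof.
move=> oA; pose q (c : 'rV[rat]_n) : 'rV[R]_n := map_mx ratr c.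
pose I := [set u : 'rV[rat]_n * rat | ball (q u.1) (ratr u.2) `<=` A].
rewrite (_ : A = \bigcup_(u in I) ball (q u.1) (ratr u.2)); last first.
  apply/seteqP; split => [x Ax|x [u + xu]]; last exact.
  have /nbhs_ballP[e /= e0 xeA] : nbhs x A by exact: open_nbhs_nbhs.
  (* A rational radius [d] below [e / 2] and a rational centre within [d] of [x] give a ball that
     contains [x] and, by the triangle inequality, stays in [ball x e]. *)
  have e20 : 0 < e / 2 by rewrite divr_gt0.
  have [d /[!in_itv]/= /andP[d0 de]] := rat_in_itvoo e20.
  have H i : exists c : rat, ball (x 0 i) (ratr d) (ratr c : R).
    have [c /[!in_itv]/= /andP[c0 ce]] : exists c : rat,
      ratr c \in `]x 0 i - ratr d, x 0 i + ratr d[%R.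
      by apply: rat_in_itvoo; rewrite ltrBlDr -addrA ltrDl addr_gt0.
    by exists c; rewrite /ball/= ltr_distlC c0.
  have [c cP] := choice H; exists (\row_i c i, d) => /=.
    move=> y [_ yd]; apply: xeA; split => // i j; rewrite ord1.
    have := yd 0 j; rewrite !mxE => yj.
    have := ball_triangle (cP j) yj; apply: le_ball.
    by rewrite (splitr e) lerD// ltW.
  by split => // i j; rewrite ord1 !mxE; apply: ball_sym; exact: cP.
rewrite bigcup_mkcond; apply: countable_bigcupT_measurable => //= u.
by case: ifPn => // _; exact: measurable_ball_row.
Qed.

(** By induction on [n]: in the maximum norm a ball is the product of a ball one dimension lower and
    an interval; in dimension 0 the measure is a Dirac mass at the only point. *)
Lemma lebesgue_row_ball_gt0 n (x : 'rV[R]_n) (e : R) : 0 < e ->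
  (0 < lebesgue_row n (ball x e))%E.
Proof.
move=> e0; elim: n x => [|n IH] x.
  by rewrite /= diracE mem_set ?lte01//; split => // i [].
rewrite /=/pushforward.
rewrite (_ : _ @^-1` _ =
    ball (\row_i x 0 (lift ord_max i)) e `*` ball (x 0 ord_max) e).
  rewrite product_measure1E//=; last 2 first.
  - exact: measurable_ball_row.
  - exact: open_measurable (ball_open _ _).
  rewrite mule_gt0// lebesgue_measure_ball ?ltW// lte_fin.
  by rewrite mulrn_wgt0.
apply/seteqP; split => -[z t] /=.
  move=> [_ H]; split => /=.
    split => // i j; rewrite ord1 mxE; have := H 0 (lift ord_max j).
    by rewrite mxE liftK.
  by have := H 0 ord_max; rewrite mxE unlift_none.
move=> [[_ H1] H2]; split => // i j; rewrite ord1 mxE.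
case: unliftP => [k ->|->] /=; last exact: H2.
by have := H1 0 k; rewrite mxE.
Qed.

Lemma negligible_ball_row n (x : 'rV[R]_n) (e : R) : 0 < e ->
  ~ (lebesgue_row n).-negligible (ball x e).
Proof.
move=> e0 /negligibleP; rewrite -/(measurable _) => /(_ (measurable_ball_row x e)) h.
by have := lebesgue_row_ball_gt0 x e0; rewrite h ltxx.
Qed.

End row_space.

(** * Square-integrable functions: bilinearity of the inner product and null functions *)

Section L2_theory.
Context d {T : measurableType d} {R : realType}.
Variables (mu : {measure set T -> \bar R}) (D : set T).
Implicit Types f g h : T -> R.

Lemma L2_lin (c : R) f g : L2 mu D f -> L2 mu D g ->
  L2 mu D (fun x => c * f x + g x).
Proof.
rewrite /L2 => lf lg.
have p1 : (1 <= 2%:E :> \bar R)%E by rewrite lee_fin ler1n.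
have := (Lfun_submod_closed mu p1).2 c _ _ lf lg.
rewrite (_ : (fun x => c * f x + g x) \_ D = c *: (f \_ D) + g \_ D) //.
apply/funext => x; rewrite [RHS](_ : _ = c * (f \_ D) x + (g \_ D) x)// !patchE.
by case: ifPn => // _; rewrite mulr0 addr0.
Qed.

(** [L2] contains the measurability of the restricted function, here the indicator of [D], and [D]
    is the preimage of 1 under it. This provides the measurability of the interfaces. *)
Lemma L2_cst1_measurable : L2 mu D (cst 1) -> measurable D.
Proof.
rewrite /L2 inE => /andP[/[!inE]/= m1 _].
have := m1 measurableT [set 1] (measurable_set1 1); rewrite setTI.
congr measurable; apply/seteqP; split => x /=; rewrite patchE.
  by case: ifPn => [/set_mem//|_ /esym/eqP]; rewrite oner_eq0.
by move=> Dx; rewrite mem_set.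
Qed.

Hypothesis mD : measurable D.

Lemma L2_measurable f : L2 mu D f -> measurable_fun D f.
Proof.
by rewrite /L2 inE => /andP[/[!inE]/= mf _]; apply/measurable_restrictT.
Qed.

Lemma L2_mul_integrable f g : L2 mu D f -> L2 mu D g ->
  mu.-integrable D (EFin \o (fun x => f x * g x)).
Proof.
move=> lf lg; have /Lfun1_integrable := Lfun2_mul_Lfun1 lf lg.
move=> H; apply/integrable_mkcond => //; congr (_.-integrable _ _): H.
apply/funext => x /=; rewrite !patchE.
by case: ifPn => // _; rewrite mul0r.
Qed.

Lemma L2ip_linl (c : R) f g h : L2 mu D f -> L2 mu D g -> L2 mu D h ->
  L2ip mu D (fun x => c * f x + g x) h = c * L2ip mu D f h + L2ip mu D g h.
Proof.
move=> lf lg lh; rewrite /L2ip.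
rewrite -RintegralZl//; last exact: L2_mul_integrable.
rewrite -RintegralD//; last exact: L2_mul_integrable.
  by apply: eq_Rintegral => x _; rewrite mulrDl mulrA.
exact: (integrableZl mD c (L2_mul_integrable lf lh)).
Qed.

Lemma Rintegral_ge0_eq0 f : mu.-integrable D (EFin \o f) ->
  (forall x, D x -> 0 <= f x) -> \int[mu]_(x in D) f x = 0 ->
  ae_eq mu D f (cst 0).
Proof.
move=> intf f0 If0; have mf := measurable_int mu intf.
suff /(ae_eq_integral_abs mu mD mf) : (\int[mu]_(x in D) `|(EFin \o f) x| = 0)%E.
  by apply: filterS => x /= h Dx; have [] := h Dx.
rewrite -[0%E]/((0:R)%:E) -If0 /Rintegral fineK ?integrable_fin_num//.
by apply: eq_integral => x /set_mem Dx /=; rewrite ger0_norm// f0.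
Qed.

Lemma L2norm_eq0 f : L2 mu D f -> L2norm mu D f = 0 -> ae_eq mu D f (cst 0).
Proof.
move=> lf /eqP; rewrite sqrtr_eq0 => If0.
have f0 x : D x -> 0 <= f x * f x by rewrite -expr2 sqr_ge0.
have /Rintegral_ge0_eq0 : mu.-integrable D (EFin \o (fun x => f x * f x)).
  exact: L2_mul_integrable.
move=> /(_ f0); case.
  by apply/le_anti; rewrite If0 Rintegral_ge0.
move=> N [mN N0 sN]; exists N; split => //; apply: subset_trans sN.
by move=> x /= h1 h2; apply: h1 => /h2 /eqP; rewrite mulf_eq0 orbb => /eqP.
Qed.

(** The measurability of [f] is not among the assumptions; it follows from completeness, since
    [f * f] agrees almost everywhere with a constant. *)
Lemma ae_eq0_L2norm f : measure_is_complete mu -> ae_eq mu D f (cst 0) ->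
  L2norm mu D f = 0.
Proof.
move=> cmu f0; rewrite /L2norm /L2ip.
have ff0 : ae_eq mu D (EFin \o (fun x => f x * f x)) (cst 0%E).
  by apply: filterS f0 => x /= h Dx; rewrite h// mulr0.
rewrite /Rintegral (ae_eq_integral (cst 0%E))//.
- by rewrite integral0 sqrtr0.
- apply: (ae_measurable_fun cmu (f := cst 0%E)) => //.
  exact: ae_eq_sym.
Qed.

End L2_theory.

(** * Integrals of finite sums *)

Section finite_sums.
Context d (T : measurableType d) (R : realType).
Variables (mu : {measure set T -> \bar R}) (D : set T).
Variables (m : nat) (h : 'I_m -> T -> R).
Hypothesis mD : measurable D.
Hypothesis hi : forall i, mu.-integrable D (EFin \o h i).

Lemma integrable_sumR : mu.-integrable D (EFin \o (fun x => \sum_i h i x)).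
Proof.
rewrite (_ : _ \o _ = (fun x => \sum_i (h i x)%:E)%E).
  by apply: integrable_sum => // i _; exact: hi.
by apply/funext => x /=; rewrite -sumEFin.
Qed.

Lemma Rintegral_sum :
  \int[mu]_(x in D) (\sum_i h i x) = \sum_i \int[mu]_(x in D) h i x.
Proof.
rewrite /Rintegral; under eq_integral do rewrite -sumEFin.
rewrite integral_sum// -sum_fine// => i _.
exact: (integrable_fin_num mD (hi i)).
Qed.

End finite_sums.

(** * The Euclidean inner product *)

Section dot_theory.
Context {R : realType} {n : nat}.
Implicit Types (u v w x y : 'rV[R]_n) (A : 'M[R]_n).

Lemma dot_mx x y : dot x y = (x *m y^T) 0 0.
Proof. by rewrite mxE; apply: eq_bigr => j _; rewrite !mxE. Qed.

Lemma dotC x y : dot x y = dot y x.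
Proof. by apply: eq_bigr => j _; rewrite mulrC. Qed.

Lemma dot_linl (c : R) x y w : dot (c *: x + y) w = c * dot x w + dot y w.
Proof. by rewrite !dot_mx mulmxDl -scalemxAl !mxE. Qed.

Lemma dot_ge0 x : 0 <= dot x x.
Proof. by apply: sumr_ge0 => j _; rewrite -expr2 sqr_ge0. Qed.

Lemma dot_eq0 x : dot x x = 0 -> x = 0.
Proof.
move=> /eqP; rewrite psumr_eq0; last by move=> j _; rewrite -expr2 sqr_ge0.
move=> /allP h; apply/rowP => j; rewrite mxE; apply/eqP.
by have := h j (mem_index_enum _); rewrite /= mulf_eq0 orbb.
Qed.

Lemma dot_mulmxr x y A : dot (x *m A) y = dot x (y *m A^T).
Proof. by rewrite !dot_mx trmx_mul trmxK mulmxA. Qed.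

(** Young's inequality with weight [k]: coordinate by coordinate, the difference of the two sides is
    a multiple of a square. *)
Lemma dot_le (k : R) x y : 0 < k ->
  2 * dot x y <= k^-1 * dot x x + k * dot y y.
Proof.
move=> k0; rewrite /dot !mulr_sumr -big_split/=; apply: ler_sum => j _.
rewrite -subr_ge0 (_ : _ - _ = k^-1 * (x 0 j - k * y 0 j) ^+ 2).
  by rewrite mulr_ge0 ?sqr_ge0// invr_ge0 ltW.
by field; rewrite gt_eqF.
Qed.

Lemma normr_dot_le x y : `|dot x y| <= dot x x + dot y y.
Proof.
have H z : 2 * dot z y <= dot z z + dot y y.
  by have := dot_le z y ltr01; rewrite invr1 !mul1r.
have N z : dot (- x) z = - dot x z by rewrite !dot_mx mulNmx mxE.
have NN : dot (- x) (- x) = dot x x by rewrite N dotC N opprK.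
have := H x; have := H (- x); rewrite NN N.
have := dot_ge0 x; have := dot_ge0 y.
by rewrite ler_norml => *; apply/andP; split; lra.
Qed.

End dot_theory.

(** * Measurability of determinants and inverse matrices *)

Section measurable_matrix.
Context d {T : measurableType d} {R : realType}.
Variable D : set T.

(** Writing the inverse of [y] as [y] times the power -1 of [y ^+ 2] reduces the claim to real
    powers of nonnegative numbers; at [y = 0] both sides are 0 by convention. *)
Lemma measurable_funV (f : T -> R) :
  measurable_fun D f -> measurable_fun D (fun x => (f x)^-1).
Proof.
move=> mf; rewrite (_ : (fun x => _) = (fun x => f x * (f x ^+ 2) `^ (-1))).
  apply: measurable_funM => //.
  exact: (measurableT_comp (measurable_powR (-1)) (measurable_funX 2 mf)).
apply/funext => x; rewrite powR_inv1 ?sqr_ge0//.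
have [->|f0] := eqVneq (f x) 0; first by rewrite invr0 mul0r.
by rewrite expr2 invfM mulrA mulfV// mul1r.
Qed.

Lemma measurable_det m (A : T -> 'M[R]_m) :
  (forall i j, measurable_fun D (fun x => A x i j)) ->
  measurable_fun D (fun x => \det (A x)).
Proof.
move=> mA; apply: measurable_sum => s; apply: measurable_funM => //.
by apply: measurable_prod => i _.
Qed.

(** By Cramer's rule the entries of the inverse are cofactors divided by the determinant. *)
Lemma measurable_invmx m (A : T -> 'M[R]_m) :
  (forall x, D x -> A x \in unitmx) ->
  (forall i j, measurable_fun D (fun x => A x i j)) ->
  forall i j, measurable_fun D (fun x => invmx (A x) i j).
Proof.
move=> uA mA i j.
apply: (eq_measurable_fun
    (fun x => (\det (A x))^-1 * ((-1) ^+ (j + i) * \det (row' j (col' i (A x)))))).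
  by move=> x /set_mem Dx; rewrite /invmx uA// !mxE.
apply: measurable_funM; first exact/measurable_funV/measurable_det.
apply: measurable_funM => //; apply: measurable_det => k l.
by under eq_fun do rewrite !mxE; exact: mA.
Qed.

End measurable_matrix.

(** * Square-integrable vector fields *)

Section vector_L2.
Context {R : realType} {n : nat}.

Definition vL2 (D : set 'rV[R]_n) (u : 'rV[R]_n -> 'rV[R]_n) :=
  forall j, L2 (lebesgue_row n) D (fun x => u x 0 j).

Lemma vL2_dot_integrable (D : set 'rV[R]_n) (u v : 'rV[R]_n -> 'rV[R]_n) :
  measurable D ->
  vL2 D u -> vL2 D v ->
  (lebesgue_row n).-integrable D (EFin \o (fun x => dot (u x) (v x))).
Proof.
by move=> mD lu lv; apply: integrable_sumR => // j; exact: L2_mul_integrable.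
Qed.

End vector_L2.

(** * The inverse of the elliptic tensor *)

Section elliptic.
Context {R : realType} {n : nat}.
Variables (Om : set 'rV[R]_n) (K : 'rV[R]_n -> 'M[R]_n) (kmin kmax : R).
Hypothesis elliptic : elliptic_tensor Om K kmin kmax.
Implicit Types u v : 'rV[R]_n.

(** A vector [v] in the kernel satisfies [kmin * dot v v <= 0], hence is zero. *)
Lemma elliptic_unitmx x : Om x -> K x \in unitmx.
Proof.
case: elliptic => k0 _ _ _ eK Ox.
rewrite -row_free_unit -kermx_eq0; apply/eqP/row_matrixP => i.
rewrite row0; apply: dot_eq0; set v := row i _.
have vK : v *m K x = 0 by apply/sub_kermxP; exact: row_sub.
have /andP[+ _] := eK x Ox v; rewrite vK (dot_mx 0) mul0mx mxE.
by rewrite pmulr_rle0// => v0; apply/le_anti; rewrite v0 dot_ge0.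
Qed.

Lemma elliptic_invmx_sym x u v : Om x ->
  dot (u *m invmx (K x)) v = dot (v *m invmx (K x)) u.
Proof.
case: elliptic => _ _ _ sK _ Ox.
by rewrite dot_mulmxr trmx_inv sK// dotC.
Qed.

(** This is the lower ellipticity bound at the vector [u *m invmx (K x)]. *)
Lemma elliptic_invmx_ge x u : Om x ->
  kmin * dot (u *m invmx (K x)) (u *m invmx (K x)) <= dot (u *m invmx (K x)) u.
Proof.
case: elliptic => _ _ _ _ eK Ox.
have /andP[+ _] := eK x Ox (u *m invmx (K x)).
by rewrite mulmxKV ?elliptic_unitmx// (dotC u).
Qed.

Lemma elliptic_invmx_ge0 x u : Om x -> 0 <= dot (u *m invmx (K x)) u.
Proof.
case: elliptic => k0 _ _ _ _ Ox.
by apply: le_trans (elliptic_invmx_ge u Ox); rewrite mulr_ge0 ?dot_ge0// ltW.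
Qed.

Lemma elliptic_invmx_eq0 x u : Om x -> dot (u *m invmx (K x)) u = 0 -> u = 0.
Proof.
case: elliptic => k0 _ _ _ _ Ox u0; have := elliptic_invmx_ge u Ox.
rewrite u0 pmulr_rle0// => h.
have /dot_eq0 Ku0 : dot (u *m invmx (K x)) (u *m invmx (K x)) = 0.
  by apply/le_anti; rewrite h dot_ge0.
by rewrite -(mulmxKV (elliptic_unitmx Ox) u) Ku0 mul0mx.
Qed.

(** With [w = u *m invmx (K x)], [elliptic_invmx_ge] gives [kmin * dot w w <= dot u w]; Young's
    inequality with weight [kmin] then lets half of the right-hand side be absorbed on the left. *)
Lemma elliptic_invmx_le x u : Om x ->
  dot (u *m invmx (K x)) (u *m invmx (K x)) <= kmin^-1 ^+ 2 * dot u u.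
Proof.
case: elliptic => k0 _ _ _ _ Ox; have := elliptic_invmx_ge u Ox.
set w := u *m _; rewrite dotC => h.
have := dot_le u w k0 => h2.
rewrite -(ler_pM2l k0) expr2 !mulrA mulfV ?gt_eqF// mul1r.
by move: h h2; set a := kmin * _; set b := _ * dot u u; lra.
Qed.

Lemma elliptic_integrable (D : set 'rV[R]_n) (u v : 'rV[R]_n -> 'rV[R]_n) :
  open Om -> measurable D ->
  D `<=` Om -> vL2 D u -> vL2 D v ->
  (lebesgue_row n).-integrable D
    (EFin \o (fun x => dot (u x *m invmx (K x)) (v x))).
Proof.
move=> oOm mD DOm lu lv; have [k0 _ mK _ _] := elliptic.
have mOm := open_measurable_row oOm.
have mu j := L2_measurable mD (lu j).
have mv j := L2_measurable mD (lv j).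
(* The dominating function comes from bounding the inner product by the sum of the two squares and
   then applying [elliptic_invmx_le]. *)
apply: (@le_integrable _ _ _ (lebesgue_row n) D mD _
  (EFin \o (fun x => kmin^-1 ^+ 2 * dot (u x) (u x) + dot (v x) (v x)))).
- apply/measurable_EFinP/measurable_sum => j; apply: measurable_funM => //.
  under eq_fun do rewrite mxE.
  apply: measurable_sum => k; apply: measurable_funM => //.
  apply: (measurable_funS mOm DOm); apply: measurable_invmx mK _ _.
  exact: elliptic_unitmx.
- move=> x Dx; rewrite /= lee_fin.
  apply: (le_trans (normr_dot_le _ _)); apply: le_trans (ler_norm _).
  by rewrite lerD2r; apply: elliptic_invmx_le; exact: DOm.
- have iu := integrableZl mD (kmin^-1 ^+ 2) (vL2_dot_integrable mD lu lu).
  exact: (integrableD mD iu (vL2_dot_integrable mD lv lv)).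
Qed.

End elliptic.

(** * Polynomials that vanish almost everywhere, and piecewise polynomials *)

Section broken_theory.
Context {R : realType} {n : nat}.
Local Notation pt := 'rV[R]_n.
Implicit Types q : mpoly.mpoly n R.

Lemma pevalE q (x : pt) : peval q x = \sum_(m <- mpoly.msupp q)
  mpoly.mcoeff m q * \prod_i x 0 i ^+ mpoly.fun_of_multinom m i.
Proof. exact: mpoly.mevalE. Qed.

Lemma peval_lin (c : R) q q' x : peval (c *: q + q') x = c * peval q x + peval q' x.
Proof. by rewrite /peval mpoly.mevalD mpoly.mevalZ. Qed.

Lemma continuous_peval q : continuous (peval q).
Proof.
rewrite (_ : peval q = fun x : pt => \sum_(m <- mpoly.msupp q)
    mpoly.mcoeff m q * \prod_i x 0 i ^+ mpoly.fun_of_multinom m i); last first.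
  by apply/funext => x; exact: pevalE.
have ca : continuous (fun u : R * R => u.1 + u.2).
  by move=> u; apply: cvgD; [exact: cvg_fst|exact: cvg_snd].
have cm : continuous (fun u : R * R => u.1 * u.2).
  by move=> u; apply: cvgM; [exact: cvg_fst|exact: cvg_snd].
move=> x; apply: (cvg_big ca (nbhs_filter x)) => m _.
apply: cvgM; first exact: cvg_cst.
apply: (cvg_big cm (nbhs_filter x)) => i _.
exact: (cvg_comp _ _ (@coord_continuous R 1 n 0 i x) (@exprn_continuous R _ _)).
Qed.

Lemma peval_line q (x v : pt) :
  exists p : {poly R}, forall t, peval q (x + t *: v) = p.[t].
Proof.
exists (\sum_(m <- mpoly.msupp q) (mpoly.mcoeff m q)%:P *
  \prod_i ((x 0 i)%:P + (v 0 i)%:P * 'X) ^+ mpoly.fun_of_multinom m i) => t.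
rewrite pevalE horner_sum; apply: eq_bigr => m _.
rewrite hornerM hornerC horner_prod; congr (_ * _); apply: eq_bigr => i _.
by rewrite horner_exp !hornerE !mxE (mulrC t).
Qed.

Lemma poly_eq0_near0 (p : {poly R}) (e : R) : 0 < e ->
  (forall t, 0 < t < e -> p.[t] = 0) -> p = 0.
Proof.
move=> e0 pe.
(* These are [size p] distinct roots, more than the degree allows; the denominators start at 2 so
   that all points lie strictly below [e]. *)
pose s := [seq e / i.+2%:R | i <- iota 0 (size p)].
apply: (@roots_geq_poly_eq0 _ p s).
- apply/allP => _ /mapP[i _ ->]; apply/eqP/pe.
  by rewrite divr_gt0//= ltr_pdivrMr// ltr_pMr// ltr1n.
- rewrite map_inj_uniq ?iota_uniq// => i j /(mulfI (lt0r_neq0 e0))/invr_inj/eqP.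
  by rewrite eqr_nat => /eqP[].
- by rewrite size_map size_iota.
Qed.

(** On the line from [x] through [y] the polynomial becomes univariate and vanishes for all small
    positive parameters, hence also at the parameter 1, which is [y]. *)
Lemma peval_eq0_ball q (x : pt) (e : R) : 0 < e ->
  (forall y, ball x e y -> peval q y = 0) -> forall y, peval q y = 0.
Proof.
move=> e0 q0 y; have [p pE] := peval_line q x (y - x).
suff p0 : p = 0 by have := pE 1; rewrite scale1r addrC subrK p0 horner0.
(* The added 1 keeps the denominator of the parameter bound positive when [y = x]. *)
have n0 : 0 < `|y - x| + 1 by rewrite ltr_wpDl.
apply: (@poly_eq0_near0 p (e / (`|y - x| + 1))); first exact: divr_gt0.
move=> t /andP[t0 te]; rewrite -pE q0// -ball_normE /= opprD addNKr normrN.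
rewrite normrZ gtr0_norm//; move: te; rewrite ltr_pdivlMr//.
by apply: le_lt_trans; rewrite ler_pM2l// lerDl.
Qed.

(** By continuity a nonzero value at a point of [A] would persist on a small ball inside [A], and
    balls are not negligible. So [q] vanishes on a ball, hence everywhere. *)
Lemma peval_ae_eq0 q (A : set pt) : open A -> A !=set0 ->
  ae_eq (lebesgue_row n) A (peval q) (cst 0) -> forall y, peval q y = 0.
Proof.
move=> oA [x Ax] q0.
have /nbhs_ballP[e /= e0 xA] : nbhs x A by exact: open_nbhs_nbhs.
apply: (@peval_eq0_ball q x e e0) => z xz; apply: contrapT => /eqP qz0.
have : nbhs z (ball x e `&` [set w | peval q w != 0]).
  apply: filterI; first exact: (open_nbhs_nbhs (conj (ball_open x e) xz)).
  have oq := (continuousP _).1 (@continuous_peval q) _ (@open_neq R 0).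
  exact: (open_nbhs_nbhs (conj oq qz0)).
move=> /nbhs_ballP[r /= r0 zr]; apply: (negligible_ball_row (x := z) r0).
by apply: negligibleS q0 => w /zr[/xA Aw /eqP qw] /= /(_ Aw).
Qed.

Section mesh.
Variables (N : nat) (T : 'I_N -> set pt).

Lemma beval_lin (c : R) (w w' : broken R n N) x :
  beval T (c *: w + w') x = c * beval T w x + beval T w' x.
Proof.
rewrite /beval mulr_sumr -big_split; apply: eq_bigr => k _ /=.
by rewrite !ffunE peval_lin; ring.
Qed.

Lemma vpeval_lin (c : R) (v v' : {ffun 'I_n -> mpoly.mpoly n R}) x :
  vpeval (c *: v + v') x = c *: vpeval v x + vpeval v' x.
Proof. by apply/rowP => j; rewrite !mxE !ffunE peval_lin. Qed.

Lemma vbeval_lin (c : R) (v v' : vbroken R n N) x :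
  vbeval T (c *: v + v') x = c *: vbeval T v x + vbeval T v' x.
Proof.
rewrite /vbeval scaler_sumr -big_split; apply: eq_bigr => k _ /=.
by rewrite !ffunE vpeval_lin scalerDr !scalerA (mulrC c).
Qed.

Lemma bdiv_lin (c : R) (v v' : vbroken R n N) :
  bdiv (c *: v + v') = c *: bdiv v + bdiv v'.
Proof.
apply/ffunP => k; rewrite !ffunE scaler_sumr -big_split; apply: eq_bigr => j _ /=.
by rewrite !ffunE mpoly.mderivD mpoly.mderivZ.
Qed.

Lemma ntrace_lin D (c : R) (v v' : vbroken R n N) x :
  ntrace T D (c *: v + v') x = c * ntrace T D v x + ntrace T D v' x.
Proof.
rewrite /ntrace mulr_sumr -big_split; apply: eq_bigr => k _ /=.
by rewrite !ffunE vpeval_lin dot_linl; ring.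
Qed.

Lemma ntrace_eq0 D (v : vbroken R n N) :
  (forall k x, vpeval (v k) x = 0) -> forall x, ntrace T D v x = 0.
Proof.
move=> v0 x; rewrite /ntrace big1// => k _.
by rewrite v0 dot_mx mul0mx mxE mulr0.
Qed.

Hypothesis T_disjoint : forall k l, k != l -> (T k)° `&` (T l)° = set0.

Lemma vbeval_interior (v : vbroken R n N) k x : (T k)° x ->
  vbeval T v x = vpeval (v k) x.
Proof.
move=> Tkx; rewrite /vbeval (bigD1 k)//= indicE mem_set// scale1r big1 ?addr0//.
move=> l lk; rewrite indicE memNset ?scale0r// => Tlx.
by have : ((T l)° `&` (T k)°) x by []; rewrite T_disjoint.
Qed.

Lemma vbeval_exterior (v : vbroken R n N) x : (forall k, ~ (T k)° x) ->
  vbeval T v x = 0.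
Proof.
by move=> Tx; rewrite /vbeval big1// => k _; rewrite indicE memNset ?scale0r.
Qed.

End mesh.
End broken_theory.

Lemma fin_dim_subspace_lin (R : realType) (E : lmodType R) (V : set E) :
  fin_dim_subspace V -> forall (c : R) u v, V u -> V v -> V (c *: u + v).
Proof.
move=> [m [e ->]] c _ _ [a _ <-] [b _ <-]; exists (fun i => c * a i + b i) => //.
rewrite scaler_sumr -big_split; apply: eq_bigr => i _ /=.
by rewrite scalerDl scalerA.
Qed.

(** * One subdomain: the energy of discrete fields and the extension problem *)

Section subdomain.
Context {R : realType} {n M : nat}.
Local Notation pt := 'rV[R]_n.
Local Notation leb := (@lebesgue_row R n).
Local Notation surf := (surface R n).

Definition energy (K : pt -> 'M[R]_n) (D : set pt) (u v : pt -> pt) : R :=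
  \int[leb]_(x in D) dot (u x *m invmx (K x)) (v x).

(** Elements cover only the closure of [D]; as [D] has no slits, the interior of that closure is [D]
    itself. *)
Lemma mesh_interior_sub (D : set pt) (sigma : R) N (T : 'I_N -> set pt) :
  polygonal_domain D -> shape_regular_affine_mesh sigma D T ->
  forall k, (T k)° `<=` D.
Proof.
move=> pD mT k; rewrite -(polygonal_regular pD); apply: interiorS.
by rewrite (mesh_cover mT) => x Tx; exists k.
Qed.

Lemma mesh_interior_neq0 (D : set pt) (sigma : R) N (T : 'I_N -> set pt) :
  shape_regular_affine_mesh sigma D T -> forall k, (T k)° !=set0.
Proof.
move=> mT k; have [x [r r0 [xrT _]]] := mesh_shape_regular mT k.
exists x; apply/nbhs_ballP.
(* In the maximum norm a ball of radius [e] lies in the inscribed Euclidean ball of radius [r],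
   because [n * e ^+ 2 <= (n.+1 * e) ^+ 2 = r ^+ 2]. *)
pose e := r / n.+1%:R; have e0 : 0 < e by rewrite divr_gt0.
exists e => //= y [_ xy]; apply: xrT => /=.
rewrite /enorm -[leRHS]gtr0_norm// -sqrtr_sqr ler_wsqrtr//.
apply: (@le_trans _ _ (\sum_(j < n) e ^+ 2)).
  apply: ler_sum => j _; rewrite -expr2 -real_normK ?num_real//.
  rewrite lerXn2r ?nnegrE ?(ltW e0)// !mxE distrC ltW//; exact: xy.
rewrite sumr_const card_ord -mulr_natl (_ : r = n.+1%:R * e); last first.
  by rewrite mulrC mulfVK.
rewrite [leRHS]exprMn ler_pM2r ?exprn_gt0// -natrX ler_nat.
by rewrite (leq_trans (leqnSn n))// -{1}[n.+1]expn1 leq_pexp2l.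
Qed.

Variables (Omi : 'I_M -> set pt) (i : 'I_M) (N : nat) (T : 'I_N -> set pt).
Variables (V : set (vbroken R n N)) (W : set (broken R n N)).
Hypothesis mixed : mixed_pair Omi i T V W.
Hypothesis oOmi : open (Omi i).

Let mOmi : measurable (Omi i).
Proof. exact: open_measurable_row. Qed.

Let V_lin (c : R) u v : V u -> V v -> V (c *: u + v).
Proof. exact: fin_dim_subspace_lin (mixed_V_subspace mixed) c u v. Qed.

Lemma mixed_vL2 v : V v -> vL2 (Omi i) (vbeval T v).
Proof. by move=> /(mixed_Hdiv mixed)[]. Qed.

Lemma mixed_div_L2 v : V v -> L2 leb (Omi i) (beval T (bdiv v)).
Proof. by move=> /(mixed_Hdiv mixed)[]. Qed.

Lemma mixed_W_L2 w : W w -> L2 leb (Omi i) (beval T w).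
Proof. by rewrite (mixed_div mixed) => -[v Vv <-]; exact: mixed_div_L2. Qed.

Lemma L2ip_div_linl (c : R) u v w : V u -> V v -> W w ->
  L2ip leb (Omi i) (beval T (bdiv (c *: u + v))) (beval T w) =
  c * L2ip leb (Omi i) (beval T (bdiv u)) (beval T w) +
  L2ip leb (Omi i) (beval T (bdiv v)) (beval T w).
Proof.
move=> Vu Vv Ww; rewrite bdiv_lin (funext (beval_lin T c _ _)) L2ip_linl//.
- exact: mixed_div_L2.
- exact: mixed_div_L2.
- exact: mixed_W_L2.
Qed.

Variables (Om : set pt) (K : pt -> 'M[R]_n) (kmin kmax : R).
Hypothesis oOm : open Om.
Hypothesis OmiOm : Omi i `<=` Om.
Hypothesis elliptic : elliptic_tensor Om K kmin kmax.

Local Notation A u v := (energy K (Omi i) (vbeval T u) (vbeval T v)).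

Lemma mixed_energy_integrable u v : V u -> V v -> leb.-integrable (Omi i)
  (EFin \o (fun x => dot (vbeval T u x *m invmx (K x)) (vbeval T v x))).
Proof.
by move=> Vu Vv; apply: (elliptic_integrable elliptic) => //; exact: mixed_vL2.
Qed.

Lemma energy_linr (c : R) u v v' : V u -> V v -> V v' ->
  A u (c *: v + v') = c * A u v + A u v'.
Proof.
move=> Vu Vv Vv'; rewrite /energy -RintegralZl//; last exact: mixed_energy_integrable.
rewrite -RintegralD//; last exact: mixed_energy_integrable.
  apply: eq_Rintegral => x _; rewrite vbeval_lin dotC dot_linl.
  by rewrite !(dotC _ (_ *m _)).
exact: (integrableZl mOmi c (mixed_energy_integrable Vu Vv)).
Qed.

Lemma energy_sym u v : A u v = A v u.
Proof.
apply: eq_Rintegral => x /set_mem Ox.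
by rewrite (elliptic_invmx_sym elliptic)//; exact: OmiOm.
Qed.

Lemma energy_ge0 u : 0 <= A u u.
Proof.
apply: Rintegral_ge0 => x Ox.
by rewrite (elliptic_invmx_ge0 elliptic)//; exact: OmiOm.
Qed.

(** The integrand is nonnegative, so it vanishes almost everywhere, and by ellipticity so does the
    field. Inside an element the field is polynomial, and the interior of an element is a nonempty
    open set. *)
Lemma energy_eq0 (sigma : R) u : polygonal_domain (Omi i) ->
  shape_regular_affine_mesh sigma (Omi i) T ->
  V u -> A u u = 0 -> forall k x, vpeval (u k) x = 0.
Proof.
move=> pOmi mT Vu Au0 k x; apply/rowP => j; rewrite !mxE.
apply: (@peval_ae_eq0 _ _ _ (T k)°).
- exact: open_interior.
- exact: mesh_interior_neq0 mT k.
have u0 y : Omi i y -> 0 <= dot (vbeval T u y *m invmx (K y)) (vbeval T u y).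
  by move=> Oy; rewrite (elliptic_invmx_ge0 elliptic)//; exact: OmiOm.
have := Rintegral_ge0_eq0 mOmi (mixed_energy_integrable Vu Vu) u0 Au0.
apply: filterS => y h Tky.
have Oy := mesh_interior_sub pOmi mT Tky.
have /(elliptic_invmx_eq0 elliptic (OmiOm Oy)) := h Oy.
rewrite (vbeval_interior (mesh_disjoint mT) u Tky) => /rowP/(_ j).
by rewrite !mxE.
Qed.

(* Testing Darcy's law with [v - u'], which has no normal trace; the pressure
   is orthogonal to the divergence of [u'], which lies in the coarse space. *)
Lemma extension_energy q q' u p r u' p' r' v :
  is_extension Omi i T V W K q u p r -> is_extension Omi i T V W K q' u' p' r' ->
  V v -> ae_eq surf (Gamma_of Omi i) (ntrace T (Omi i) v) q' ->
  A u v - L2ip leb (Omi i) (beval T (bdiv v)) (beval T p) = A u u'.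
Proof.
move=> ext ext' Vv tv.
have [Vu Wp] := (extension_V ext, extension_W ext); have Vu' := extension_V ext'.
have V0w : V0 Omi i T V (-1 *: u' + v).
  split; first exact: V_lin.
  apply: filterS2 (extension_trace ext') tv => x h h' Gx.
  by rewrite ntrace_lin h// h'// mulN1r addNr.
have := extension_darcy ext V0w; rewrite -/(A u (-1 *: u' + v)).
rewrite energy_linr// L2ip_div_linl//.
(* The mass equation of [u'], tested with the pressure [p] of the other extension, replaces the
   divergence of [u'] by the coarse function [r']; the mean condition on [p] then removes this
   term. *)
have /eqP := extension_mass ext' Wp; rewrite subr_eq0 => /eqP ->.
have := extension_mean ext (extension_S ext').
rewrite /L2ip; under eq_Rintegral do rewrite mulrC.
move=> ->; rewrite mulr0 add0r mulN1r -addrA addrC => /eqP.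
by rewrite subr_eq0 => /eqP.
Qed.

End subdomain.

(** * Assembling the subdomains *)

Section global.
Context {R : realType} {n M : nat}.
Local Notation pt := 'rV[R]_n.
Local Notation leb := (@lebesgue_row R n).
Local Notation surf := (surface R n).
Variables (Om : set pt) (Omi : 'I_M -> set pt).
Hypothesis decomposition : domain_decomposition Om Omi.
Variables (K : pt -> 'M[R]_n) (kmin kmax : R).
Hypothesis elliptic : elliptic_tensor Om K kmin kmax.
Variables (sigma : R) (N : 'I_M -> nat) (T : forall i, 'I_(N i) -> set pt).
Local Arguments T : clear implicits.
Hypothesis mesh : forall i, shape_regular_affine_mesh sigma (Omi i) (T i).
Variables (V : forall i, set (vbroken R n (N i))).
Local Arguments V : clear implicits.
Variables (W : forall i, set (broken R n (N i))).
Local Arguments W : clear implicits.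
Hypothesis mixed : forall i, mixed_pair Omi i (T i) (V i) (W i).

Let oOm : open Om.
Proof. exact: polygonal_open (decomposition_domain decomposition). Qed.

Let oOmi i : open (Omi i).
Proof. exact: polygonal_open (decomposition_subdomain decomposition i). Qed.

Let OmiOm i : Omi i `<=` Om.
Proof. exact: decomposition_sub decomposition i. Qed.

Lemma vbeval_outside i (v : vbroken R n (N i)) x : ~ Omi i x ->
  vbeval (T i) v x = 0.
Proof.
move=> Ox; apply: vbeval_exterior => k Tkx; apply: Ox.
exact: (mesh_interior_sub (decomposition_subdomain decomposition i) (mesh i) Tkx).
Qed.

Lemma vglobal_inside (u : forall i, vbroken R n (N i)) i x : Omi i x ->
  vglobal T u x = vbeval (T i) (u i) x.
Proof.
move=> Ox; rewrite /vglobal (bigD1 i)//= big1 ?addr0// => j ji.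
apply: vbeval_outside => Oj.
by have : (Omi j `&` Omi i) x by []; rewrite (decomposition_disjoint decomposition).
Qed.

Lemma vglobal_outside (u : forall i, vbroken R n (N i)) x :
  (forall i, ~ Omi i x) -> vglobal T u x = 0.
Proof. by move=> Ox; rewrite /vglobal big1// => i _; exact: vbeval_outside. Qed.

(** Piecewise polynomials are 0 outside the interiors of their elements, so the integrand over [Om]
    equals the sum of the local integrands [F i] at every point, interfaces included. *)
Lemma a_form_energy (u v : forall i, vbroken R n (N i)) :
  (forall i, V i (u i)) -> (forall i, V i (v i)) ->
  a_form T Om K u v =
  \sum_i energy K (Omi i) (vbeval (T i) (u i)) (vbeval (T i) (v i)).
Proof.
move=> Vu Vv.
pose F i x := dot (vbeval (T i) (u i) x *m invmx (K x)) (vbeval (T i) (v i) x).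
have F0 i x : ~ Omi i x -> F i x = 0.
  by move=> Ox; rewrite /F (vbeval_outside _ Ox) mul0mx dot_mx mul0mx mxE.
(* Since [F i] vanishes off [Omi i], its integrals over [Om] and over [Omi i] are those of the same
   restricted function. *)
have FOm i : F i \_ Om = F i \_ (Omi i).
  apply/funext => x; rewrite !patchE; have [Ox|/negP Ox] := boolP (x \in Omi i).
    by rewrite (mem_set (OmiOm (set_mem Ox))).
  by case: ifPn => // _; apply: F0 => /mem_set.
transitivity (\int[leb]_(x in Om) \sum_i F i x).
  apply: eq_Rintegral => x _; have [[i Ox]|nOx] := pselect (exists i, Omi i x).
    rewrite !(vglobal_inside _ Ox) (bigD1 i)//= big1 ?addr0// => j ji.
    apply: F0 => Oj.
    by have : (Omi j `&` Omi i) x by []; rewrite (decomposition_disjoint decomposition).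
  have {}nOx i : ~ Omi i x by move=> Ox; apply: nOx; exists i.
  rewrite vglobal_outside// mul0mx dot_mx mul0mx mxE big1// => i _.
  exact/F0/nOx.
have mOm := open_measurable_row oOm.
rewrite Rintegral_sum//; last first.
  move=> i; have mOmi := open_measurable_row (@oOmi i).
  have := mixed_energy_integrable (mixed i) (@oOmi i) oOm (@OmiOm i) elliptic (Vu i) (Vv i).
  move/(integrable_mkcond _ mOmi) => H.
  apply/(integrable_mkcond _ mOm); congr (_.-integrable _ _): H.
  by rewrite !restrict_EFin -/(F i) FOm.
apply: eq_bigr => i _.
by rewrite /energy [LHS]Rintegral_mkcond [RHS]Rintegral_mkcond -/(F i) FOm.
Qed.

(** * Mortar functions on the interfaces *)

Variable L : 'I_M -> 'I_M -> set (pt -> R).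
Hypothesis mortar : forall i j : 'I_M, (i < j)%N ->
  mortar_space (interface Omi i j) (L i j).

Lemma Lambda_h_lin (c : R) lambda mu : Lambda_h Omi L lambda ->
  Lambda_h Omi L mu -> Lambda_h Omi L (fun x => c * lambda x + mu x).
Proof.
move=> [lamL lamh] [muL muh]; split; first exact: L2_lin.
move=> i j ij; move: (lamh _ _ ij) (muh _ _ ij).
have [m [e ->]] := mortar_subspace (mortar ij) => -[a ae_a] [b ae_b].
exists (fun k => c * a k + b k); apply: filterS2 ae_a ae_b => x ha hb Gx.
rewrite ha// hb// mulr_sumr -big_split; apply: eq_bigr => k _ /=.
by rewrite mulrDl mulrA.
Qed.

(** The mortar space contains the constant 1 and consists of square-integrable functions, which
    forces the interface to be measurable. *)
Lemma interface_measurable (i j : 'I_M) : (i < j)%N ->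
  measurable (interface Omi i j : set (surface_type R n)).
Proof.
move=> ij; apply: (@L2_cst1_measurable _ _ _ surf).
exact: (mortar_L2 (mortar ij) (mortar_constant (mortar ij) 1)).
Qed.

Variable Q : (pt -> R) -> 'I_M -> pt -> R.
Hypothesis Q_mortar : mortar_condition Omi L Q.

(** On each interface both projections on the right of the mortar condition are null, so [lambda]
    has norm zero there; [Gamma] is the union of finitely many interfaces. *)
Lemma mortar_eq0 lambda : Lambda_h Omi L lambda ->
  (forall i, ae_eq surf (Gamma_of Omi i) (Q lambda i) (cst 0)) ->
  ae_eq surf (Gamma Omi) lambda (cst 0).
Proof.
move=> lamh Q0; have [C C0 CQ] := Q_mortar.
have H (i j : 'I_M) : \forall x \ae surf,
    (i < j)%N -> interface Omi i j x -> lambda x = 0.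
  have [ij|ji] := ltnP i j; last first.
    exact: aeW.
  have mG := interface_measurable ij.
  have sub_i : interface Omi i j `<=` Gamma_of Omi i.
    by move=> x Gx; split; [exists i, j|case: Gx].
  have sub_j : interface Omi i j `<=` Gamma_of Omi j.
    by move=> x Gx; split; [exists i, j|case: Gx].
  have Qn0 k : interface Omi i j `<=` Gamma_of Omi k ->
      L2norm surf (interface Omi i j) (Q lambda k) = 0.
    move=> sub; apply: (ae_eq0_L2norm mG).
      exact: measure_is_complete_caratheodory.
    by apply: filterS (Q0 k) => x h /sub.
  have := CQ lambda lamh i j ij; rewrite !Qn0// addr0 mulr0 => n0.
  have : L2norm surf (interface Omi i j) lambda = 0.
    by apply/le_anti; rewrite n0 sqrtr_ge0.
  move/(L2norm_eq0 mG (mortar_L2 (mortar ij) (lamh.2 i j ij))).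
  by apply: filterS => x h _ Gx; exact: h.
have ae_filter := ae_filter_ringOfSetsType surf.
(* Finitely many pairs of indices allow one common null set for all interfaces. *)
have : \forall x \ae surf, forall ij : 'I_M * 'I_M,
    (ij.1 < ij.2)%N -> interface Omi ij.1 ij.2 x -> lambda x = 0.
  by apply: (@filter_forall _ _ _ (almost_everywhere surf)) => -[i j]; exact: H.
by apply: (@filterS _ _ ae_filter) => x h [i [j [ij Gx]]]; exact: (h (i, j)).
Qed.

(** * The interface form: energy identity, bilinearity and positivity *)

Variables (Rh : (pt -> R) -> forall i, vbroken R n (N i)).
Variables (p r : (pt -> R) -> forall i, broken R n (N i)).
Hypothesis Rh_extension : forall lambda, Lambda Omi lambda -> forall i,
  is_extension Omi i (T i) (V i) (W i) K (Q lambda i)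
    (Rh lambda i) (p lambda i) (r lambda i).
Variable Rt : (pt -> R) -> forall i, vbroken R n (N i).
Hypothesis Rt_extension : extension_operator Omi T V L Rt Q.

Local Notation aG := (a_Gamma Omi T Rt Om K Rh p).

Let V_Rh lambda : Lambda_h Omi L lambda -> forall i, V i (Rh lambda i).
Proof. by move=> [lamL _] i; exact: extension_V (Rh_extension lamL i). Qed.

(** This sums [extension_energy] over the subdomains with [v] the local part of [Rt mu], whose
    normal trace is [Q mu]; the choice of [Rt] drops out. *)
Lemma a_Gamma_energy lambda mu : Lambda_h Omi L lambda -> Lambda_h Omi L mu ->
  aG lambda mu = \sum_i energy K (Omi i)
    (vbeval (T i) (Rh lambda i)) (vbeval (T i) (Rh mu i)).
Proof.
move=> lamh muh; have Vt := extop_V Rt_extension muh.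
rewrite /a_Gamma a_form_energy//; last exact: V_Rh.
rewrite /b_form -sumrB; apply: eq_bigr => i _.
apply: (extension_energy (mixed i) (@oOmi i) oOm (@OmiOm i) elliptic
  (Rh_extension lamh.1 i) (Rh_extension muh.1 i) (Vt i)).
exact: extop_trace Rt_extension mu muh i.
Qed.

Lemma a_Gamma_sym lambda mu : Lambda_h Omi L lambda -> Lambda_h Omi L mu ->
  aG lambda mu = aG mu lambda.
Proof.
move=> lamh muh; rewrite !a_Gamma_energy//; apply: eq_bigr => i _.
exact: energy_sym (@OmiOm i) elliptic _ _.
Qed.

(** The second argument enters through [Rt], which is linear by assumption. The first enters through
    [Rh] and [p], known only as solutions, so linearity there is left to symmetry. *)
Lemma a_Gamma_linr (c : R) lambda mu mu' : Lambda_h Omi L lambda ->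
  Lambda_h Omi L mu -> Lambda_h Omi L mu' ->
  aG lambda (fun x => c * mu x + mu' x) = c * aG lambda mu + aG lambda mu'.
Proof.
move=> lamh muh muh'; have V_Rt := extop_V Rt_extension.
have muh2 := Lambda_h_lin c muh muh'.
rewrite /a_Gamma !a_form_energy ?/b_form -?sumrB; try exact: V_Rh; try exact: V_Rt.
rewrite mulr_sumr -big_split; apply: eq_bigr => i _ /=.
rewrite (extop_linear Rt_extension)//.
rewrite (energy_linr (mixed i) (@oOmi i) oOm (@OmiOm i) elliptic);
  try exact: V_Rh; try exact: V_Rt.
rewrite (L2ip_div_linl (mixed i) (@oOmi i)); try exact: V_Rt; first by ring.
exact: extension_W (Rh_extension lamh.1 i).
Qed.

Lemma a_Gamma_gt0 lambda : Lambda_h Omi L lambda ->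
  ~ ae_eq surf (Gamma Omi) lambda (cst 0) -> 0 < aG lambda lambda.
Proof.
move=> lamh lam0; rewrite a_Gamma_energy//.
have E0 i (_ : true) : 0 <= energy K (Omi i)
    (vbeval (T i) (Rh lambda i)) (vbeval (T i) (Rh lambda i)).
  exact: energy_ge0 (@OmiOm i) elliptic _.
(* If the sum of nonnegative energies were zero, each of them would be, and [energy_eq0] would apply
   on every subdomain. *)
rewrite lt_neqAle sumr_ge0// andbT eq_sym; apply/negP => /eqP/psumr_eq0P.
move=> /(_ E0) {}E0; apply: lam0; apply: mortar_eq0 => // i.
have u0 := energy_eq0 (mixed i) (@oOmi i) oOm (@OmiOm i) elliptic
  (decomposition_subdomain decomposition i) (mesh i) (V_Rh lamh i)
  (E0 i isT).
apply: filterS (extension_trace (Rh_extension lamh.1 i)) => x h Gx.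
by rewrite -h// ntrace_eq0.
Qed.

End global.

(** Mortar functions are not identified when they agree almost everywhere, so a nonzero argument is
    one that is not almost everywhere 0 on [Gamma]. The first conclusion records that the form is
    bilinear. *)
Theorem lemma6p1 (R : realType) (n : nat) (n23 : n = 2%N \/ n = 3%N)
  (M : nat) (Om : set 'rV[R]_n) (Omi : 'I_M -> set 'rV[R]_n)
  (decomposition : domain_decomposition Om Omi)
  (K : 'rV[R]_n -> 'M[R]_n) (kmin kmax : R)
  (elliptic : elliptic_tensor Om K kmin kmax)
  (sigma : R) (N : 'I_M -> nat) (T : forall i, 'I_(N i) -> set 'rV[R]_n)
  (mesh : forall i, shape_regular_affine_mesh sigma (Omi i) (T i))
  (V : forall i, set (vbroken R n (N i))) (W : forall i, set (broken R n (N i)))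
  (mixed : forall i, mixed_pair Omi i (T i) (V i) (W i))
  (L : 'I_M -> 'I_M -> set ('rV[R]_n -> R))
  (mortar : forall i j : 'I_M, (i < j)%N ->
    mortar_space (interface Omi i j) (L i j))
  (Q : variant -> ('rV[R]_n -> R) -> 'I_M -> 'rV[R]_n -> R)
  (Q_flat : forall lambda, Lambda Omi lambda ->
    flat_projection Omi T V lambda (Q Flat lambda))
  (Q_sharp : forall lambda, Lambda Omi lambda ->
    sharp_projection Omi T V L lambda (Q Sharp lambda))
  (bullet : variant)
  (mortar_flat : mortar_condition Omi L (Q Flat))
  (mortar_sharp : bullet = Sharp -> mortar_condition Omi L (Q Sharp))
  (Rh : ('rV[R]_n -> R) -> forall i, vbroken R n (N i))
  (p r : ('rV[R]_n -> R) -> forall i, broken R n (N i))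
  (Rh_extension : forall lambda, Lambda Omi lambda -> forall i,
    is_extension Omi i (T i) (V i) (W i) K (Q bullet lambda i)
      (Rh lambda i) (p lambda i) (r lambda i))
  (Rt : ('rV[R]_n -> R) -> forall i, vbroken R n (N i))
  (Rt_extension : extension_operator Omi T V L Rt (Q bullet)) :
  let L0 := Lambda_h0 Omi T L Rt in
  let aG := a_Gamma Omi T Rt Om K Rh p in
  [/\ forall lambda lambda' mu, L0 lambda -> L0 lambda' -> L0 mu ->
        forall c : R,
          aG (fun x => c * lambda x + lambda' x) mu
            = c * aG lambda mu + aG lambda' mu /\
          aG mu (fun x => c * lambda x + lambda' x)
            = c * aG mu lambda + aG mu lambda',
      forall lambda mu, L0 lambda -> L0 mu -> aG lambda mu = aG mu lambda &
      forall lambda, L0 lambda ->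
        ~ ae_eq (surface R n) (Gamma Omi) lambda (cst 0) -> 0 < aG lambda lambda].
Proof.
move=> L0 aG.
(* The flat mortar condition always holds; the sharp one is available exactly when that variant is
   chosen. *)
have Q_mortar : mortar_condition Omi L (Q bullet).
  by move: mortar_sharp; case: (bullet) => // H; exact: H.
have L0h mu : L0 mu -> Lambda_h Omi L mu by case.
have linr := a_Gamma_linr decomposition elliptic mesh mixed mortar
  Rh_extension Rt_extension.
have sym := a_Gamma_sym decomposition elliptic mesh mixed Rh_extension Rt_extension.
split.
- move=> lambda lambda' mu /L0h lamh /L0h lamh' /L0h muh c; split.
    (* Symmetry turns linearity in the first argument into linearity in the second; it applies to
       the combination because [Lambda_h] is closed under linear combinations. *)
    have lamh2 := Lambda_h_lin mortar c lamh lamh'.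
    by rewrite /aG !(sym _ mu)// linr.
  exact: linr.
- by move=> lambda mu /L0h lamh /L0h muh; exact: sym.
- move=> lambda /L0h lamh; exact: (a_Gamma_gt0 decomposition elliptic mesh mixed mortar
    Q_mortar Rh_extension Rt_extension lamh).
Qed.
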